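(* There exists a (topologically) 2-generated prosupersolvable group $G$ such that $$\liminf_{n\to\infty}\frac{\tilde\beta_n(G)}{\tilde\gamma_n(G)}=0.$$
   Context: Let $G$ be a finitely generated profinite group. The M\''obius function $\mu(\cdot,G)$ of the lattice of open subgroups of $G$ is defined by $\mu(G,G)=1$ and $\sum_{H\le K\le G}\mu(K,G)=0$ for every proper open subgroup $H$ of $G$. $\tilde\beta_n(G)$ denotes the number of conjugacy classes of open subgroups $H$ of $G$ with index at most $n$ and with $\mu(H,G)\ne 0$. $\tilde\gamma_n(G)$ denotes the number of conjugacy classes of open subgroups of $G$ with index at most $n$ that are intersections of (open) maximal subgroups of $G$. *)

(* Defs.v *)
From HB Require Import structures.
From mathcomp Require Import all_boot all_order all_algebra all_fingroup all_solvable.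
From mathcomp Require Import finmap.
From mathcomp Require Import all_classical all_reals all_analysis.

Set Implicit Arguments.
Unset Strict Implicit.
Unset Printing Implicit Defensive.

Local Open Scope classical_set_scope.
Local Open Scope group_scope.

HB.mixin Record isTopologicalGroup G of monoid.Group G & Topological G := {
  mulg_continuous : continuous (fun p : G * G => p.1 * p.2);
  invg_continuous : continuous (fun x : G => x^-1)
}.

#[short(type="topologicalGroupType")]
HB.structure Definition TopologicalGroup :=
  {G of monoid.Group G & Topological G & isTopologicalGroup G}.

Definition supersolvable (gT : finGroupType) (G : {group gT}) : Prop :=
  exists s : seq {group gT},
    path [rel H K : {group gT} |
            [&& H \subset K, normal K G & cyclic (K / H)]] 1%G s
    /\ last 1%G s = G.

Section TopologicalGroups.
Variable G : topologicalGroupType.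
Implicit Types H K M : set G.

Definition profinite : Prop :=
  [/\ compact [set: G], hausdorff_space G & totally_disconnected [set: G]].

(* Every finite quotient of G by an open normal subgroup is supersolvable; such
   quotients are the finite groups gT that are continuous homomorphic images of
   G, where gT carries the discrete topology. *)
Definition prosupersolvable : Prop :=
  profinite /\
  forall (gT : finGroupType) (f : {multiplicative G -> gT}),
    range f = [set: gT] -> (forall A : set gT, open (f @^-1` A)) ->
    supersolvable [set: gT]%G.

Definition subgroup H : Prop :=
  [/\ H 1, forall x y, H x -> H y -> H (x * y) & forall x, H x -> H x^-1].

Definition topologically_2generated : Prop :=
  exists x y : G, closure (smallest subgroup [set x; y]) = [set: G].

Definition open_subgroup H : Prop := subgroup H /\ open H.

Definition left_cosets H : set (set G) :=
  [set [set x * h | h in H] | x in [set: G]].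

Definition index_le H (n : nat) : Prop := (left_cosets H #<= `I_n)%card.

Definition conj_class H : set (set G) :=
  [set [set h ^ g | h in H] | g in [set: G]].

Definition maximal_subgroup M : Prop :=
  [/\ open_subgroup M, M <> [set: G] &
      forall K, subgroup K -> M `<=` K -> K = M \/ K = [set: G]].

(* G itself is included, as the intersection of the empty family. *)
Definition intersection_of_maximals H : Prop :=
  exists F : set (set G), F `<=` maximal_subgroup /\ H = \bigcap_(M in F) M.

(* In a profinite group each H has only finitely many K above it, so the sum is
   finite and these equations determine mu on all open subgroups; the values of
   mu on other sets are irrelevant. *)
Definition mobius_function (mu : set G -> int) : Prop :=
  mu [set: G] = 1%R /\
  forall H, open_subgroup H -> H <> [set: G] ->
    (\sum_(K \in [set K | open_subgroup K /\ H `<=` K]) mu K = 0)%R.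

(* The numbers of classes below are finite in a (topologically) finitely
   generated profinite group; fset_set returns the empty set on infinite sets. *)
Definition beta_tilde (mu : set G -> int) (n : nat) : nat :=
  #|` fset_set (conj_class @`
       [set H | [/\ open_subgroup H, index_le H n & mu H <> 0%R]])|%fset.

Definition gamma_tilde (n : nat) : nat :=
  #|` fset_set (conj_class @`
       [set H | [/\ open_subgroup H, index_le H n
                  & intersection_of_maximals H]])|%fset.

End TopologicalGroups.

(* Main.v *)
(* The group is G = prod_j G_j with G_j = F_p >< C_{q^2} a Frobenius group
   (p, q primes depending on j, q^2 | p - 1).  Up to conjugacy the intersections
   of maximal subgroups of G_j are its subgroups of orders p q^2, p q, q^2, q, 1;
   the Moebius function vanishes on the last one, because C_{q^2} has order
   divisible by a square, and not on the other four.  If all the primes dividing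
   |G_j| exceed n_j = prod_(i < j) |G_i|, then the open subgroups of G are
   products of subgroups of the G_j, the Moebius function is multiplicative, and
   a subgroup of index at most n_k contains prod_(j >= k) G_j.  So at n = n_k the
   ratio is (4/5)^k. *)
From HB Require Import structures.
Require Import Defs.
From mathcomp Require Import all_boot all_order all_algebra all_fingroup all_solvable.
From mathcomp Require Import all_field zify.
Set Implicit Arguments.
Unset Strict Implicit.
Unset Printing Implicit Defensive.
Import GRing.Theory.
Local Open Scope group_scope.

(** * Frobenius blocks *)

(** In each G_j the trivial subgroup is an intersection of maximal subgroups, since point
    stabilisers of a Frobenius group meet trivially. Its Moebius value is nevertheless 0: above it
    lie G_j and the subgroup of order p q, which cancel, and the p complements C_{q^2}, which cancel
    against the p subgroups of order q that they contain. The size condition asks for more than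
    coprimality. Coprimality already splits open subgroups, but an index bound n_k must also force a
    subgroup to be full in every factor G_j with j >= k, and the least prime divisor of |G_j| is a
    lower bound for its proper indices. As only a liminf is wanted, it suffices to look at the
    numbers n_k, with an upper bound for the numerator and a lower bound for the denominator. The
    existence of p = 1 mod q^2 is a case of Dirichlet's theorem with an elementary cyclotomic
    proof. *)

Definition affine (F : finFieldType) (U : {group {unit F}}) : Type := (F * subg_of U)%type.

Section AffineGroup.
Variables (F : finFieldType) (U : {group {unit F}}).
Local Notation aff := (affine U).
HB.instance Definition _ := Finite.on aff.

Definition scal (a : subg_of U) : F := val (sgval a).

Lemma scalM a b : scal (a * b) = (scal a * scal b)%R.
Proof. by []. Qed.
Lemma scal1 : scal 1 = 1%R.
Proof. by []. Qed.
Lemma scal_inj : injective scal.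
Proof. by move=> a b /val_inj /val_inj. Qed.

(** The pair [(v, a)] stands for the affine map x -> v + a x of F, and the product is
    composition. *)
Definition aff_mul (g h : aff) : aff := ((g.1 + scal g.2 * h.1)%R, g.2 * h.2).
Definition aff_one : aff := (0%R, 1).
Definition aff_inv (g : aff) : aff := ((- (scal g.2^-1 * g.1))%R, g.2^-1).

Fact aff_mulA : associative aff_mul.
Proof. by move=> [v a] [w b] [x c]; rewrite /aff_mul /= mulgA mulrDr addrA mulrA scalM. Qed.
Fact aff_mul1 : left_id aff_one aff_mul.
Proof. by move=> [v a]; rewrite /aff_mul /= mul1g add0r scal1 mul1r. Qed.
Fact aff_mulV : left_inverse aff_one aff_inv aff_mul.
Proof. by move=> [v a]; rewrite /aff_mul /aff_one /= mulVg addNr. Qed.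
HB.instance Definition _ := Finite_isGroup.Build aff aff_mulA aff_mul1 aff_mulV.

Lemma aff_mulE (g h : aff) : g * h = ((g.1 + scal g.2 * h.1)%R, g.2 * h.2).
Proof. by []. Qed.
Lemma aff_invE (g : aff) : g^-1 = ((- (scal g.2^-1 * g.1))%R, g.2^-1).
Proof. by []. Qed.
Lemma aff_expE2 (g : aff) n : (g ^+ n).2 = g.2 ^+ n.
Proof. by elim: n => // n IHn; rewrite !expgS aff_mulE /= IHn. Qed.

Definition aff_over (E : {group subg_of U}) : {set aff} := [set g | g.2 \in E].
Definition aff_stab0 (E : {group subg_of U}) : {set aff} :=
  [set g | (g.1 == 0%R) && (g.2 \in E)].

Fact aff_over_group_set E : group_set (aff_over E).
Proof.
apply/group_setP; split=> [|g h]; rewrite !inE ?group1 //= => gE hE.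
exact: groupM.
Qed.
Canonical aff_over_group E := Group (aff_over_group_set E).

Fact aff_stab0_group_set E : group_set (aff_stab0 E).
Proof.
apply/group_setP; split=> [|g h]; rewrite !inE ?group1 ?eqxx //=.
case/andP=> /eqP-> gE /andP[/eqP-> hE].
by rewrite mulr0 add0r eqxx groupM.
Qed.
Canonical aff_stab0_group E := Group (aff_stab0_group_set E).

Lemma card_aff_over (E : {group subg_of U}) : #|aff_over E| = (#|F| * #|E|)%N.
Proof.
rewrite -cardsT -cardsX; apply: eq_card => g.
by rewrite !inE.
Qed.
Lemma card_aff_stab0 (E : {group subg_of U}) : #|aff_stab0 E| = #|E|.
Proof.
rewrite -[RHS]mul1n -(cards1 (0%R : F)) -cardsX; apply: eq_card => g.
by rewrite !inE.
Qed.
Lemma card_aff : #|[set: aff]| = (#|F| * #|U|)%N.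
Proof. by rewrite cardsT card_prod card_sub (eq_card (B := mem U)). Qed.

(** Here [h] is a homothety x -> c x with c <> 1; its only fixed point is 0, so whatever commutes
    with it fixes 0. *)
Lemma cent_aff_stab0 (g h : aff) : h.1 = 0%R -> h.2 != 1 -> commute g h -> g.1 = 0%R.
Proof.
move=> h0 h1; rewrite /commute !aff_mulE h0 mulr0 addr0 add0r => -[/eqP].
rewrite -subr_eq0 -{1}[g.1]mul1r -mulrBl mulf_eq0 subr_eq0 => /orP[|/eqP//].
by rewrite -scal1 (inj_eq scal_inj) eq_sym (negPf h1).
Qed.

(** The equation says that [g] fixes the point -y: conjugating the stabiliser of 0 by translations
    gives all point stabilisers. *)
Lemma mem_conj_aff_stab0 (g : aff) (y : F) :
  (g \in aff_stab0 [set: subg_of U] :^ (y, 1)) = (g.1 + y == scal g.2 * y)%R.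
Proof.
rewrite mem_conjg /conjg invgK inE aff_invE !aff_mulE /= inE andbT.
by rewrite invg1 scal1 !mul1r mulrN addrCA addrA subr_eq0.
Qed.

End AffineGroup.

(** Describing the subgroup of order d by the equation a^d = 1 turns membership in it into a
    divisibility of orders. *)
Lemma cyclic_Ldiv (gT : finGroupType) d : cyclic [set: gT] -> d %| #|gT| ->
  exists E : {group gT}, #|E| = d /\ forall a : gT, (a \in E) = (a ^+ d == 1).
Proof.
move=> cycT dvd; have /cyclicP[u Tu] := cycT.
have ou : #[u] = #|gT| by rewrite -cardsT Tu.
have d_gt0 : 0 < d by apply: dvdn_gt0 dvd; rewrite -cardsT cardG_gt0.
exists <[u ^+ (#|gT| %/ d)]>%G.
have oE : #|<[u ^+ (#|gT| %/ d)]>| = d.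
  by rewrite -orderE orderXdiv ou ?dvdn_div // divnA // mulKn // -ou order_gt0.
split=> // a; rewrite -order_dvdn orderE -oE.
by rewrite (cardSg_cyclic cycT (subsetT _) (subsetT _)) cycle_subG oE.
Qed.

(* The five representatives have distinct orders, hence are not conjugate, while
   nonzero Moebius values only occur in the first four classes. *)
Record block := Block {
  block_group :> finGroupType;
  block_repr : 'I_5 -> {group block_group};
  block_mobius : {group block_group} -> int;
  block_gen1 : block_group;
  block_gen2 : block_group;
  block_repr_card : injective (fun i => #|block_repr i|);
  block_repr_maximal : forall i x, x \notin block_repr i ->
    exists M : {group block_group},
      [/\ maximal M [set: block_group], block_repr i \subset M & x \notin M];
  block_mobiusT : block_mobius [set: block_group]%G = 1%R;
  block_mobius_sum : forall H : {group block_group}, H <> [set: block_group]%G ->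
    (\sum_(K : {group block_group} | H \subset K) block_mobius K = 0)%R;
  block_mobius_neq0 : forall K : {group block_group}, block_mobius K != 0%R ->
    exists (i : 'I_5) (g : block_group), i < 4 /\ K :=: block_repr i :^ g;
  block_gen1_normal : <[block_gen1]> <| [set: block_group];
  block_gens : <[block_gen1]> * <[block_gen2]> = [set: block_group]
}.

(** * Subgroups and Moebius function of F_p >< C_{q^2} *)

Section FrobeniusBlock.
Variables (F : finFieldType) (U : {group {unit F}}) (q : nat).
Hypotheses (p_pr : prime #|F|) (q_pr : prime q) (oU : #|U| = (q ^ 2)%N) (qp : q < #|F|).
Local Notation p := #|F|.
Local Notation gT := (affine U).
Local Notation G := [set: gT]%G.

Let q_gt0 : 0 < q := prime_gt0 q_pr.
Let p_gt0 : 0 < p := prime_gt0 p_pr.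
Let q_gt1 : 1 < q := prime_gt1 q_pr.
Let cpq : coprime p q.
Proof. by rewrite prime_coprime // gtnNdvd. Qed.
Let oG : #|G| = (p * q ^ 2)%N.
Proof. by rewrite card_aff oU. Qed.

Lemma cyclic_subg : cyclic [set: subg_of U].
Proof. by rewrite -(isog_cyclic (isog_subg U)); exact: field_unit_group_cyclic. Qed.

Lemma card_subg_of : #|[set: subg_of U]| = (q ^ 2)%N.
Proof. by rewrite cardsT card_sub (eq_card (B := mem U)). Qed.

Variable E : {group subg_of U}.
Hypotheses (oE : #|E| = q) (memE : forall a, (a \in E) = (a ^+ q == 1)).

Local Notation N := (aff_over_group E).
Local Notation Q := (aff_stab0_group [set: subg_of U]).
Local Notation C := (aff_stab0_group E).

Let oN : #|N| = (p * q)%N. Proof. by rewrite card_aff_over oE. Qed.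
Let oQ : #|Q| = (q ^ 2)%N. Proof. by rewrite card_aff_stab0 card_subg_of. Qed.
Let oC : #|C| = q. Proof. by rewrite card_aff_stab0 oE. Qed.

Lemma aff_Sylow (K : {group gT}) : #|K| = (q ^ 2)%N -> q.-Sylow(G) K.
Proof.
move=> oK; rewrite pHallE subsetT /= oK oG partnM ?muln_gt0 ?expn_gt0 ?q_gt0 //.
have/part_p'nat-> : q^'.-nat p by rewrite p'natE // -prime_coprime // coprime_sym.
by rewrite part_pnat_id ?pnatX ?pnat_id // mul1n.
Qed.

Lemma aff_conj_stab0 (K : {group gT}) : #|K| = (q ^ 2)%N -> exists g, K :=: Q :^ g.
Proof.
move=> oK; have [g _ ->] := Sylow_trans (aff_Sylow oQ) (aff_Sylow oK).
by exists g.
Qed.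

(** For g in K the order of [g.2] divides both q^2 and p q, hence q. *)
Lemma aff_sub_over (K : {group gT}) : #|K| %| (p * q)%N -> K \subset N.
Proof.
move=> dvK; apply/subsetP=> g gK; rewrite inE memE -order_dvdn.
have oa : #[g.2] %| (q ^ 2)%N.
  by rewrite -card_subg_of order_dvdG ?inE.
rewrite -(@Gauss_dvdr _ p).
  rewrite order_dvdn -aff_expE2; have /dvdnP[k ->] := dvK.
  by rewrite mulnC expgM expg_cardG // expg1n.
by rewrite coprime_sym (coprime_dvdr oa) // coprimeXr.
Qed.

Lemma aff_cap_over_stab0 : N :&: Q = C.
Proof. by apply/setP=> g; rewrite !inE andbT andbC. Qed.

Lemma aff_overJ g : N :^ g = N.
Proof.
apply/eqP; rewrite eqEcard cardJg leqnn andbT.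
by apply: (@aff_sub_over (N :^ g)%G); rewrite /= cardJg oN.
Qed.

(** By Sylow K lies in some conjugate of Q, and by its order it lies in the normal subgroup N, so it
    is the corresponding conjugate of N :&: Q = C. *)
Lemma aff_conj_stab0_sub (K : {group gT}) : #|K| = q -> exists g, K :=: C :^ g.
Proof.
move=> oK; have qK : q.-group K by rewrite /pgroup oK pnat_id.
have [g _ sK] := Sylow_subJ (aff_Sylow oQ) (subsetT K) qK.
exists g; apply/eqP; rewrite eqEcard cardJg oK oC leqnn andbT.
rewrite -aff_cap_over_stab0 conjIg aff_overJ subsetI sK andbT.
by apply: aff_sub_over; rewrite oK dvdn_mull.
Qed.

Lemma aff_over_uniq (K : {group gT}) : #|K| = (p * q)%N -> K = N.
Proof.
move=> oK; apply/val_inj/eqP; rewrite /= eqEcard oK oN leqnn andbT.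
by apply: aff_sub_over; rewrite oK.
Qed.

(** A group of order q^2 is abelian, so K centralises a nontrivial element of C, whose centraliser
    fixes 0. *)
Lemma aff_stab0_uniq (K : {group gT}) : #|K| = (q ^ 2)%N -> C \subset K -> K :=: Q.
Proof.
move=> oK sCK; apply/eqP; rewrite eqEcard oK oQ leqnn andbT.
have abK : abelian K.
  by apply: card_p2group_abelian oK.
have [c cE c1] : exists2 c, c \in E & c != 1.
  by apply/trivgPn; rewrite trivg_card1 oE; case: q q_gt1 => [|[]].
have cC : ((0%R, c) : gT) \in C by rewrite !inE eqxx.
apply/subsetP=> g gK; rewrite !inE andbT; apply/eqP.
by apply: (@cent_aff_stab0 _ _ g (0%R, c)) => //; exact: (centsP abK) _ gK _ (subsetP sCK _ cC).
Qed.

Lemma aff_cap_over (K : {group gT}) : #|K| = (q ^ 2)%N -> #|K :&: N| = q.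
Proof.
case/aff_conj_stab0=> g ->.
by rewrite -[N in _ :&: N](aff_overJ g) -conjIg cardJg setIC aff_cap_over_stab0.
Qed.

(** The common intersection is a conjugate of C, and after conjugating back [aff_stab0_uniq] leaves
    Q as the only complement above it. *)
Lemma aff_cap_over_inj (K K' : {group gT}) : #|K| = (q ^ 2)%N -> #|K'| = (q ^ 2)%N ->
  K :&: N = K' :&: N -> K = K'.
Proof.
move=> oK oK' eqKK'; have [g KN] := aff_conj_stab0_sub (aff_cap_over oK).
have cQ (L : {group gT}) : #|L| = (q ^ 2)%N -> K :&: N = L :&: N -> L :=: Q :^ g.
  move=> oL eqL; apply: (canRL (conjsgKV g)).
  apply: (@aff_stab0_uniq (L :^ g^-1)%G); rewrite /= ?cardJg //.
  by rewrite -sub_conjg -KN /= eqL subsetIl.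
by apply: val_inj; rewrite /= (cQ K) // (cQ K').
Qed.

Lemma aff_dvd_cases (K : {group gT}) : (q ^ 2)%N %| #|K| \/ #|K| %| (p * q)%N.
Proof.
have dvK : #|K| %| (p * q ^ 2)%N by rewrite -oG cardSg ?subsetT.
have dvK' : #|K| %| p * gcdn #|K| ((q ^ 2)%N) by rewrite muln_gcdr dvdn_gcd dvK dvdn_mull.
have /(dvdn_pfactor _ _ q_pr)[m le_m Dm] := dvdn_gcdr #|K| ((q ^ 2)%N).
move: le_m; rewrite leq_eqVlt => /orP[/eqP m2|m2]; [left|right].
  by rewrite -m2 -Dm dvdn_gcdl.
by apply: (dvdn_trans dvK'); rewrite Dm dvdn_pmul2l // (dvdn_exp2l q (_ : m <= 1)).
Qed.

(** Subgroups of order p q or q^2 are maximal and get -1. One of order q lies below N and exactly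
    one complement, hence 1 = -(1 - 1 - 1). The orders p and 1 get 0. *)
Definition aff_mobius (K : {group gT}) : int :=
  ((#|K| == (p * q ^ 2)%N)%N%:R - (#|K| == (p * q)%N)%N%:R - (#|K| == (q ^ 2)%N)%N%:R
   + (#|K| == q)%:R)%R.

Definition overgroups (H : {group gT}) d := [set K : {group gT} | (H \subset K) && (#|K| == d)].

Lemma sum_aff_mobius (H : {group gT}) :
  (\sum_(K : {group gT} | H \subset K) aff_mobius K)%R =
  (#|overgroups H ((p * q ^ 2)%N)|%:R - #|overgroups H ((p * q)%N)|%:R
   - #|overgroups H ((q ^ 2)%N)|%:R + #|overgroups H q|%:R)%R.
Proof.
have S d : (\sum_(K : {group gT} | H \subset K) (#|K| == d)%:R = #|overgroups H d|%:R :> int)%R.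
  rewrite -natr_sum; congr _%:R%R.
  by rewrite -big_mkcondr /= sum1_card; apply: eq_card => K; rewrite !inE.
by rewrite big_split /= !sumrB !S.
Qed.

Lemma overgroups_group (H : {group gT}) : #|overgroups H ((p * q ^ 2)%N)| = 1%N.
Proof.
apply/eqP/cards1P; exists G; apply/setP=> K; rewrite !inE.
apply/andP/eqP=> [[_ /eqP oK]|->]; last by rewrite subsetT oG.
by apply/val_inj/eqP; rewrite /= eqEcard subsetT oK oG leqnn.
Qed.

Lemma aff_mobius_sum (H : {group gT}) : H <> G ->
  (\sum_(K : {group gT} | H \subset K) aff_mobius K = 0)%R.
Proof.
move=> nHG; rewrite sum_aff_mobius overgroups_group.
case: (aff_dvd_cases H) => [dvH|dvH].
  (* Here H has order q^2, as H <> G and p is prime, so only G and H contribute, with values 1 and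
     -1. *)
  have no_over d : ~~ (q ^ 2 %| d)%N -> overgroups H d = set0.
    move=> nd; apply/setP=> K; rewrite !inE; apply: contraNF nd.
    by case/andP=> sHK /eqP<-; exact: dvdn_trans dvH (cardSg sHK).
  have oH : #|H| = (q ^ 2)%N.
    have [k Dk] := dvdnP dvH.
    have : k %| p.
      rewrite -(@dvdn_pmul2r (q ^ 2)) ?expn_gt0 ?q_gt0 //.
      by rewrite -Dk -oG cardSg ?subsetT.
    have [_ pP] := primeP p_pr => /pP/orP[]/eqP k1; first by rewrite Dk k1 mul1n.
    case: nHG; apply/val_inj/eqP; rewrite /= eqEcard subsetT /=.
    by rewrite oG -k1 -Dk.
  have nqp : ~~ (q %| p) by rewrite -prime_coprime // coprime_sym.
  rewrite (no_over (p * q)%N) ?(no_over q); first last.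
  - by rewrite (expnSr q 1) expn1 dvdn_pmul2r.
  - have ltq : q < (q ^ 2)%N by rewrite -[X in X < _]expn1 ltn_exp2l.
    by rewrite gtnNdvd.
  have -> : overgroups H (q ^ 2)%N = [set H].
    apply/setP=> K; rewrite !inE; apply/andP/eqP=> [[sHK /eqP oK]|->]; last by rewrite oH.
    by apply/esym/val_inj/eqP; rewrite /= eqEcard sHK oK oH leqnn.
  by rewrite cards0 cards1 subr0 addr0 subrr.
(* Otherwise H lies in N, the only subgroup of order p q, whose term cancels that of G. *)
have -> : overgroups H ((p * q)%N) = [set N].
  apply/setP=> K; rewrite !inE; apply/andP/eqP=> [[_ /eqP/aff_over_uniq//]|->].
  by rewrite (aff_sub_over dvH) oN.
(* K |-> K :&: N matches the overgroups of order q^2 with those of order q, so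
   their contributions cancel. *)
have -> : #|overgroups H q| = #|overgroups H ((q ^ 2)%N)|.
  rewrite -(card_in_imset (f := fun K => (K :&: N)%G) (D := overgroups H ((q ^ 2)%N))).
    apply: eq_card => L; rewrite !inE; apply/andP/imsetP=> [[sHL /eqP oL]|[K]].
      have qL : q.-group L by rewrite /pgroup oL pnat_id.
      have [K sylK sLK] := Sylow_superset (subsetT L) qL.
      have oK : #|K| = (q ^ 2)%N.
        by rewrite (card_Hall sylK) -(card_Hall (aff_Sylow oQ)) oQ.
      exists K; first by rewrite inE (subset_trans sHL) //= oK.
      apply/val_inj/eqP; rewrite /= eqEcard (aff_cap_over oK) oL leqnn andbT.
      by rewrite subsetI sLK aff_sub_over // oL dvdn_mull.
    rewrite inE => /andP[sHK /eqP oK] ->; rewrite /= (aff_cap_over oK).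
    by rewrite subsetI sHK aff_sub_over.
  move=> K K'; rewrite !inE => /andP[_ /eqP oK] /andP[_ /eqP oK'] /(congr1 val) /=.
  exact: aff_cap_over_inj.
by rewrite cards1 subrr add0r addNr.
Qed.

(** The list has four entries; index 4 falls on the default [1%G], which is the fifth
    representative. *)
Definition aff_repr (i : 'I_5) : {group gT} := nth 1%G [:: G; N; Q; C] i.

Lemma aff_repr_card : injective (fun i => #|aff_repr i|).
Proof.
have ltq : q < (q ^ 2)%N by rewrite -[X in X < _]expn1 ltn_exp2l.
have lt1 : (q ^ 2)%N < (p * q)%N by rewrite expnSr expn1 ltn_pmul2r.
have lt2 : (p * q)%N < (p * q ^ 2)%N by rewrite ltn_pmul2l.
have dec i j : i < j < 5 -> #|nth 1%G [:: G; N; Q; C] j| < #|nth 1%G [:: G; N; Q; C] i|.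
  case: i => [|[|[|[|i]]]]; case: j => [|[|[|[|[|j]]]]] //= ltij;
    rewrite ?cards1 ?oG ?oN ?oQ ?oC; move: ltq lt1 lt2 q_gt1 ltij;
    move: (q ^ 2)%N (p * q)%N (p * q ^ 2)%N => x y z; lia.
move=> i j eqc; apply/val_inj; case: (ltngtP i j) => // lt.
  by have := dec i j; rewrite lt ltn_ord -/(aff_repr i) -/(aff_repr j) eqc ltnn => /(_ isT).
by have := dec j i; rewrite lt ltn_ord -/(aff_repr i) -/(aff_repr j) eqc ltnn => /(_ isT).
Qed.

Lemma aff_over_maximal : maximal N G.
Proof.
rewrite p_index_maximal ?subsetT // -divgS ?subsetT // oG oN.
by rewrite (expnSr q 1) expn1 mulnA mulKn ?muln_gt0 ?p_gt0.
Qed.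

Lemma aff_stab0_maximal g : maximal (Q :^ g) G.
Proof.
rewrite (p_index_maximal (M := (Q :^ g)%G)) ?subsetT //=.
by rewrite -divgS ?subsetT // oG cardJg oQ mulnK // expn_gt0 q_gt0.
Qed.

Lemma aff_repr_maximal i x : x \notin aff_repr i ->
  exists M : {group gT}, [/\ maximal M G, aff_repr i \subset M & x \notin M].
Proof.
have sCN : C \subset N by rewrite -aff_cap_over_stab0 subsetIl.
have sCQ : C \subset Q by rewrite -aff_cap_over_stab0 subsetIr.
case: i => -[|[|[|[|[|i]]]]] //= _; rewrite /aff_repr /=.
- by rewrite inE.
- by move=> ?; exists N; rewrite aff_over_maximal.
- by move=> ?; exists Q; rewrite -[X in maximal X _]conjsg1 aff_stab0_maximal.
- rewrite -aff_cap_over_stab0 inE negb_and => /orP[] ?.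
    by exists N; rewrite aff_over_maximal aff_cap_over_stab0.
  by exists Q; rewrite -[X in maximal X _]conjsg1 aff_stab0_maximal aff_cap_over_stab0.
case: x => v c; rewrite inE => nt1.
(* For the trivial subgroup: a nonidentity map x -> v + c x moves some point -y, and the stabiliser
   of -y is a maximal subgroup that misses it. The point 0 works if v <> 0, and -1 works if v =
   0. *)
suff [y ny] : exists y : F, (v + y != scal c * y)%R.
  exists (Q :^ ((y, 1%g) : gT))%G; rewrite aff_stab0_maximal sub1G /=.
  by rewrite mem_conj_aff_stab0.
have [v0|nv0] := eqVneq v 0%R; last by exists 0%R; rewrite addr0 mulr0.
exists 1%R; rewrite v0 add0r mulr1 -(scal1 U) (inj_eq (@scal_inj _ _)) eq_sym.
by apply: contraNneq nt1 => ->; rewrite v0.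
Qed.

Lemma aff_mobiusT : aff_mobius G = 1%R.
Proof.
have ltq : q < (q ^ 2)%N by rewrite -[X in X < _]expn1 ltn_exp2l.
have lt1 : (q ^ 2)%N < (p * q)%N by rewrite expnSr expn1 ltn_pmul2r.
have lt2 : (p * q)%N < (p * q ^ 2)%N by rewrite ltn_pmul2l.
rewrite /aff_mobius oG eqxx !gtn_eqF ?subr0 ?addr0 //.
- exact: ltn_trans ltq (ltn_trans lt1 lt2).
- exact: ltn_trans lt1 lt2.
Qed.

Lemma aff_mobius_neq0 (K : {group gT}) : aff_mobius K != 0%R ->
  exists (i : 'I_5) g, i < 4 /\ K :=: aff_repr i :^ g.
Proof.
rewrite /aff_mobius.
have [/eqP oK|_] := eqVneq #|K| (p * q ^ 2)%N.
  exists ord0, 1; split=> //; rewrite conjsg1 /aff_repr /=.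
  by apply/eqP; rewrite eqEcard subsetT oG (eqP oK) leqnn.
have [oK|_] := eqVneq #|K| (p * q)%N.
  by exists (@Ordinal 5 1 isT), 1; split=> //; rewrite conjsg1 (aff_over_uniq oK).
have [oK|_] := eqVneq #|K| (q ^ 2)%N.
  by have [g DK] := aff_conj_stab0 oK; exists (@Ordinal 5 2 isT), g.
have [oK|_] := eqVneq #|K| q.
  by have [g DK] := aff_conj_stab0_sub oK; exists (@Ordinal 5 3 isT), g.
by [].
Qed.

Let a : gT := (1%R, 1).

Lemma aff_trans_cycle : <[a]> = aff_over (1%G : {group subg_of U}).
Proof.
have oP : #|aff_over (1%G : {group subg_of U})| = p by rewrite card_aff_over cards1 muln1.
apply/esym/(@nt_gen_prime _ (aff_over_group (1%G : {group subg_of U}))); rewrite /= ?oP //.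
by rewrite !inE eqxx andbT; apply/eqP => -[/eqP]; rewrite oner_eq0.
Qed.

Lemma aff_trans_normal : <[a]> <| G.
Proof.
rewrite aff_trans_cycle; apply/normalP; split=> [|h _]; first exact: subsetT.
apply/eqP; rewrite eqEcard cardJg leqnn andbT; apply/subsetP=> _ /imsetP[g + ->].
by rewrite !inE /conjg !aff_mulE aff_invE /= => /eqP->; rewrite mul1g mulVg.
Qed.

Lemma aff_gens (u : subg_of U) : <[u]> = [set: subg_of U] ->
  <[a]> * <[(0%R, u) : gT]> = G.
Proof.
move=> genu; apply/eqP; rewrite aff_trans_cycle eqEsubset subsetT /=.
apply/subsetP=> -[v c] _.
have /cycleP[k Dc] : c \in <[u]> by rewrite genu inE.
apply/mulsgP; exists (v, 1) (((0%R, u) : gT) ^+ k); rewrite ?inE ?mem_cycle //.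
have uk : ((0%R, u) : gT) ^+ k = (0%R, u ^+ k).
  by elim: k {Dc} => // k IHk; rewrite expgS IHk aff_mulE /= mulr0 addr0 expgS.
by rewrite uk aff_mulE /= mulr0 addr0 mul1g Dc.
Qed.

End FrobeniusBlock.

(** * Existence of blocks with large prime divisors *)

Lemma exists_unit_order_sqr m : exists q, [/\ prime q, m < q &
  exists (F : finFieldType) (u : {unit F}), prime #|F| /\ #[u] = (q ^ 2)%N].
Proof.
have [q mq q_pr] := prime_above m; exists q; split=> //.
have q_gt1 := prime_gt1 q_pr.
(* r divides Phi_{q^2}(q); as this number is 1 mod q, r <> q and q has order
   exactly q^2 modulo r. *)
pose r := pdiv (\sum_(i < q) q ^ (q * i))%N.
have S_gt1 : (1 < \sum_(i < q) q ^ (q * i))%N.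
  case: q q_gt1 {mq q_pr r} => [|[|q]] // _.
  by rewrite !big_ord_recl muln0 expn0 ltnS addn_gt0 expn_gt0.
have r_pr : prime r by exact: pdiv_prime.
have charr : r \in [pchar 'F_r]%R by exact: pchar_Fp.
have S0 : (\sum_(i < q) (q%:R ^+ q) ^+ i = 0 :> 'F_r)%R.
  under eq_bigr do rewrite -exprM -natrX.
  by rewrite -natr_sum; apply/eqP; rewrite -(dvdn_pcharf charr) pdiv_dvd.
set x : 'F_r := (q%:R)%R in S0.
have xqq : (x ^+ (q ^ 2) = 1)%R.
  by apply/eqP; rewrite -subr_eq0 expnSr expn1 exprM subrX1 S0 mulr0.
have xU : x \is a GRing.unit.
  rewrite unitfE; apply/eqP => x0; move/eqP: xqq.
  by rewrite x0 expr0n expn_eq0 eqn0Ngt (ltnW q_gt1) eq_sym oner_eq0.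
(* If x^q = 1, all q terms of the sum [S0] are 1, so q = 0 in F_r, although x = q is a unit. *)
have xq : (x ^+ q != 1)%R.
  apply/eqP => xq1; move: xU; rewrite unitfE -S0 xq1.
  by under eq_bigr do rewrite expr1n; rewrite sumr_const card_ord eqxx.
pose u : {unit 'F_r} := Sub x xU.
have valX n : val (u ^+ n) = (x ^+ n)%R.
  by rewrite FinRing.val_unitX.
exists 'F_r, u; split; first by rewrite card_Fp.
have /(dvdn_pfactor _ _ q_pr)[k le_k ou] : (#[u] %| q ^ 2)%N.
  by rewrite order_dvdn; apply/eqP/val_inj; rewrite valX xqq.
move: le_k; rewrite ou leq_eqVlt => /orP[/eqP->//|lt_k].
case/eqP: xq; rewrite -valX; have /eqP-> // : u ^+ q == 1.
by rewrite -order_dvdn ou (dvdn_exp2l q (_ : k <= 1)).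
Qed.

Lemma exists_block m :
  exists B : block, forall r, prime r -> r %| #|B| -> m < r.
Proof.
have [q [q_pr mq [F [u [p_pr ou]]]]] := exists_unit_order_sqr m.
have qp : q < #|F|.
  have : (q ^ 2 %| #|F|.-1)%N.
    by rewrite -ou -card_finField_unit order_dvdG ?inE.
  have p1 : 0 < #|F|.-1 by rewrite -subn1 subn_gt0 prime_gt1.
  move/(dvdn_leq p1) => le1; rewrite -(prednK (prime_gt0 p_pr)) ltnS.
  by apply: leq_trans le1; rewrite -[X in X <= _]expn1 leq_exp2l // prime_gt1.
pose U := <[u]>%G; have oU : #|U| = (q ^ 2)%N by [].
have /cyclicP[w genw] := cyclic_subg U.
have oW := card_subg_of oU.
have [|E [oE memE]] := @cyclic_Ldiv (subg_of U) q (cyclic_subg U).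
  by rewrite -cardsT oW dvdn_mulr.
exists (Block (aff_repr_card p_pr q_pr oU qp oE) 
  (aff_repr_maximal p_pr q_pr oU oE) (aff_mobiusT p_pr q_pr oU qp)
  (aff_mobius_sum p_pr q_pr oU qp oE memE) (aff_mobius_neq0 p_pr q_pr oU qp oE memE)
  (aff_trans_normal _ p_pr) (aff_gens p_pr (esym genw))) => r r_pr.
rewrite -cardsT /= card_aff oU Euclid_dvdM // Euclid_dvdX // andbT.
rewrite !dvdn_prime2 // => /orP[] /eqP-> //; exact: ltn_trans qp.
Qed.

From mathcomp Require Import all_classical all_reals all_analysis.
Import Order.TTheory Num.Theory.
Local Open Scope classical_set_scope.
Local Open Scope group_scope.

(** * Products of finite groups of coprime orders *)

Definition prodgroup (T : nat -> finGroupType) : Type := forall j, T j.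

(** * The product as a profinite group *)

Section ProdGroup.
Variable T : nat -> finGroupType.
Local Notation G := (prodgroup T).
Implicit Types (x y z : G) (k : nat) (A : set G).

HB.instance Definition _ := gen_eqMixin G.
HB.instance Definition _ := gen_choiceMixin G.

Definition prodg_mul x y : G := fun j => x j * y j.
Definition prodg_one : G := fun j => 1.
Definition prodg_inv x : G := fun j => (x j)^-1.

Fact prodg_mulA : associative prodg_mul.
Proof. by move=> x y z; apply: functional_extensionality_dep => j; exact: mulgA. Qed.
Fact prodg_mul1g : left_id prodg_one prodg_mul.
Proof. by move=> x; apply: functional_extensionality_dep => j; exact: mul1g. Qed.
Fact prodg_mulg1 : right_id prodg_one prodg_mul.
Proof. by move=> x; apply: functional_extensionality_dep => j; exact: mulg1. Qed.
Fact prodg_mulVg : left_inverse prodg_one prodg_inv prodg_mul.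
Proof. by move=> x; apply: functional_extensionality_dep => j; exact: mulVg. Qed.
Fact prodg_mulgV : right_inverse prodg_one prodg_inv prodg_mul.
Proof. by move=> x; apply: functional_extensionality_dep => j; exact: mulgV. Qed.

HB.instance Definition _ := isGroup.Build G
  prodg_mulA prodg_mul1g prodg_mulg1 prodg_mulVg prodg_mulgV.

(** [cylinder k 1] is the open normal subgroup prod_(j >= k) T_j; these subgroups form a
    neighbourhood base at 1. *)
Definition cylinder k x : set G := [set y | forall j, j < k -> x j = y j].

Lemma cylinder_le k l x : k <= l -> cylinder l x `<=` cylinder k x.
Proof. by move=> kl y xy j jk; exact/xy/(leq_trans jk kl). Qed.

Lemma cylinder_sub k x y : cylinder k x y -> cylinder k y `<=` cylinder k x.
Proof. by move=> xy z yz j jk; rewrite xy ?yz. Qed.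

(* The product of the discrete topologies. *)
Definition prodg_nbhs x : set_system G := [set A | exists k, cylinder k x `<=` A].

HB.instance Definition _ := hasNbhs.Build G prodg_nbhs.

Fact prodg_nbhs_filter x : ProperFilter (prodg_nbhs x).
Proof.
apply: Build_ProperFilter.
  by case=> k /(_ x); apply.
split=> [|A B [k kA] [l lB]|A B AB [k kA]].
- by exists 0.
- exists (maxn k l) => y xy; split; [apply: kA|apply: lB];
    by apply: cylinder_le xy; rewrite ?leq_maxl ?leq_maxr.
- by exists k; exact: subset_trans AB.
Qed.

Fact prodg_nbhs_singleton x A : prodg_nbhs x A -> A x.
Proof. by case=> k; apply. Qed.

Fact prodg_nbhs_nbhs x A : prodg_nbhs x A -> prodg_nbhs x (prodg_nbhs^~ A).
Proof.
case=> k kA; exists k => y xy; exists k.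
exact: subset_trans (cylinder_sub xy) kA.
Qed.

HB.instance Definition _ := Nbhs_isNbhsTopological.Build G
  prodg_nbhs_filter prodg_nbhs_singleton prodg_nbhs_nbhs.

Lemma prodg_nbhsE x A : nbhs x A <-> exists k, cylinder k x `<=` A.
Proof. by []. Qed.

Lemma prodg_openE A : open A <-> forall x, A x -> exists k, cylinder k x `<=` A.
Proof. by rewrite openE. Qed.

Lemma open_cylinder k x : open (cylinder k x).
Proof. by apply/prodg_openE => y xy; exists k; exact: cylinder_sub. Qed.

Lemma nbhs_cylinder k x : nbhs x (cylinder k x).
Proof. by exists k. Qed.

Fact prodg_mul_continuous : continuous (fun p : G * G => p.1 * p.2).
Proof.
move=> [x y] A /prodg_nbhsE[k kA].
exists (cylinder k x, cylinder k y); first by split; exact: nbhs_cylinder.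
move=> [x' y'] [/= xx' yy']; apply: kA => j jk.
by rewrite /= /mul /= /prodg_mul /= xx' ?yy'.
Qed.

Fact prodg_inv_continuous : continuous (fun x : G => x^-1).
Proof.
move=> x A /prodg_nbhsE[k kA]; exists k => y xy; apply: kA => j jk.
by congr _^-1; exact: xy.
Qed.

HB.instance Definition _ := isTopologicalGroup.Build G
  prodg_mul_continuous prodg_inv_continuous.

Lemma prodg_mulE x y j : (x * y) j = x j * y j. Proof. by []. Qed.
Lemma prodg_invE x j : x^-1 j = (x j)^-1. Proof. by []. Qed.
Lemma prodg_expE x n j : (x ^+ n) j = x j ^+ n.
Proof. by elim: n => // n IHn; rewrite !expgS prodg_mulE IHn. Qed.

(** As T_j is finite, an ultrafilter contains a fibre of the j-th coordinate for every j; the point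
    with these coordinates is its limit. *)
Lemma prodg_compact : compact [set: G].
Proof.
rewrite compact_ultra => F FU _.
have fib j : exists a : T j, F [set x | x j = a].
  apply: contrapT => nF.
  have FN a : F [set x | x j <> a].
    by case: (in_ultra_setVsetC [set x | x j = a] FU) => // Fa; case: nF; exists a.
  have [x /(_ (x j))] := filter_ex (filter_forall ultra_proper FN).
  by apply.
pose z : G := fun j => sval (cid (fib j)).
exists z; split=> // A [k kA]; apply: filterS kA _.
elim: k => [|k IHk]; first exact: filterS filterT.
have := svalP (cid (fib k)); rewrite -/(z k) => Fk.
apply: filterS (filterI IHk Fk) => x [xz xk] j.
by rewrite ltnS leq_eqVlt => /orP[/eqP->|/xz].
Qed.

Lemma prodg_hausdorff : hausdorff_space G.
Proof.
move=> x y clxy; apply: functional_extensionality_dep => j.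
have [z [xz yz]] := clxy _ _ (nbhs_cylinder j.+1 x) (nbhs_cylinder j.+1 y).
by rewrite xz ?yz.
Qed.

Lemma clopen_cylinder k x : clopen (cylinder k x).
Proof.
split; first exact: open_cylinder.
rewrite -openC; apply/prodg_openE => y nxy; exists k => z yz xz; apply: nxy => j jk.
by rewrite yz ?xz.
Qed.

Lemma prodg_totally_disconnected : totally_disconnected [set: G].
Proof.
apply: zero_dimension_totally_disconnected => x y /eqP nxy.
have [j nj] : exists j, x j <> y j.
  apply: contrapT => nj; apply: nxy; apply: functional_extensionality_dep => j.
  by apply: contrapT => ne; apply: nj; exists j.
exists (cylinder j.+1 x); split=> //; first exact: clopen_cylinder.
by move/(_ j (ltnSn j)).
Qed.

Lemma prodg_profinite : profinite (prodgroup T : topologicalGroupType).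
Proof.
split; [exact: prodg_compact|exact: prodg_hausdorff|exact: prodg_totally_disconnected].
Qed.

End ProdGroup.

(** * Open subgroups are products of subgroups of the factors *)

Section CoprimeProd.
Variable T : nat -> finGroupType.
Hypothesis coT : forall i j, i != j -> coprime #|T i| #|T j|.
Local Notation G := (prodgroup T : topologicalGroupType).
Implicit Types (x y z : G) (k : nat) (A H : set G).

Definition prodg_ins i (a : T i) : G := eqtype.dfwith (fun j => 1 : T j) a.

Lemma prodg_ins_in i (a : T i) : prodg_ins a i = a.
Proof. exact: eqtype.dfwith_in. Qed.

Lemma prodg_ins_out i (a : T i) j : i != j -> prodg_ins a j = 1.
Proof. exact: eqtype.dfwith_out. Qed.

Lemma prodg_insM i (a b : T i) : prodg_ins (a * b) = prodg_ins a * prodg_ins b.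
Proof.
apply: functional_extensionality_dep => j; rewrite prodg_mulE.
have [<-|ij] := eqVneq i j; first by rewrite !prodg_ins_in.
by rewrite !prodg_ins_out ?mulg1.
Qed.

Lemma prodg_insX i (a : T i) n : prodg_ins (a ^+ n) = prodg_ins a ^+ n.
Proof.
elim: n => [|n IHn]; last by rewrite !expgS prodg_insM IHn.
apply: functional_extensionality_dep => j.
have [<-|ij] := eqVneq i j; first by rewrite prodg_ins_in.
by rewrite !prodg_ins_out.
Qed.

(* Take m = 1 mod #|T i| and m = 0 mod #|T j| for the other j < k. *)
Lemma prodg_ins_expg k i x : exists m, cylinder k (x ^+ m) (prodg_ins (x i)).
Proof.
pose M := (\prod_(j < k | val j != i) #|T j|)%N.
have coM : coprime #|T i| M.
  apply: (big_ind (fun m => coprime #|T i| m)); first exact: coprimen1.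
    by move=> m n cm cn; rewrite coprimeMr cm.
  by move=> j ji; rewrite coT // eq_sym.
exists (chinese #|T i| M 1 0) => j jk; rewrite prodg_expE.
have expT (l : nat) (a : T l) m n : m = n %[mod #|T l|] -> a ^+ m = a ^+ n.
  have aT : a ^+ #|T l| = 1 by rewrite -cardsT expg_cardG ?inE.
  by move=> mn; rewrite -(expg_mod m aT) mn expg_mod.
have [<-|ij] := eqVneq i j.
  by rewrite prodg_ins_in (expT _ _ _ 1%N) ?expg1 // chinese_modl.
rewrite prodg_ins_out // (expT _ _ _ 0%N) ?expg0 //.
have /dvdnP[c Mc] : #|T j| %| M.
  by rewrite /M (bigD1 (Ordinal jk)) ?dvdn_mulr //= eq_sym.
apply/eqP; rewrite mod0n -/(dvdn _ _); apply: (@dvdn_trans M).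
  by rewrite Mc dvdn_mull.
by rewrite /dvdn (chinese_modr coM) mod0n.
Qed.

Lemma subgroupX H x n : subgroup H -> H x -> H (x ^+ n).
Proof.
by case=> H1 HM _ Hx; elim: n => [|n IHn]; rewrite ?expg0 ?expgS //; exact: HM.
Qed.

Lemma subgroup_cylinder H k x y :
  subgroup H -> cylinder k 1 `<=` H -> H x -> cylinder k x y -> H y.
Proof.
case=> _ HM _ kH Hx xy; rewrite -(mulKVg x y); apply: HM => //.
by apply: kH => j jk; rewrite prodg_mulE prodg_invE xy // mulVg.
Qed.

Lemma open_subgroup_cylinder H : open_subgroup H -> exists k, cylinder k 1 `<=` H.
Proof. by case=> -[H1 _ _] /prodg_openE/(_ _ H1). Qed.

Lemma cylinder_open_subgroup H k : subgroup H -> cylinder k 1 `<=` H -> open_subgroup H.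
Proof.
move=> sH kH; split=> //; apply/prodg_openE => x Hx; exists k => y.
exact: subgroup_cylinder.
Qed.

(** Generating a group makes the definition total; for a morphism and a subgroup it adds nothing to
    the image. *)
Definition img_group (gT : finGroupType) (f : G -> gT) H : {group gT} :=
  <<finset (fun u => `[< exists2 x, H x & f x = u >])>>%G.

Lemma img_groupP (gT : finGroupType) (f : G -> gT) H u :
    {morph f : x y / x * y} -> subgroup H ->
  u \in img_group f H <-> exists2 x, H x & f x = u.
Proof.
move=> fM [H1 HM HV]; set A := finset (fun u => `[< exists2 x, H x & f x = u >]).
have inP v : v \in A <-> exists2 x, H x & f x = v.
  by rewrite finset.in_set; split=> /asboolP.
have gA : group_set A.
  apply/group_setP; split=> [|v w /inP[x Hx xv] /inP[y Hy yw]]; apply/inP.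
    by exists 1 => //; apply: (mulgI (f 1)); rewrite -fM !mulg1.
  by exists (x * y); [exact: HM | rewrite fM xv yw].
by rewrite /= (gen_set_id gA).
Qed.

Definition proj H j : {group T j} := img_group (fun x => x j) H.

Lemma projP H j (a : T j) : subgroup H -> a \in proj H j <-> exists2 x, H x & x j = a.
Proof. exact: img_groupP. Qed.

Lemma mem_proj H j x : subgroup H -> H x -> x j \in proj H j.
Proof. by move=> sH Hx; apply/projP => //; exists x. Qed.

(** This is where coprimality acts: a suitable power of x agrees with the inserted coordinate up to
    an element of [cylinder k 1], which H contains. *)
Lemma subgroup_ins H k j (a : T j) : subgroup H -> cylinder k 1 `<=` H ->
  a \in proj H j -> H (prodg_ins a).
Proof.
move=> sH kH /(projP _ sH)[x Hx <-]; have [m km] := prodg_ins_expg k j x.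
exact: subgroup_cylinder (subgroupX m sH Hx) km.
Qed.

Definition trunc k x : G := fun j => if j < k then x j else 1.

Lemma truncS k x : trunc k.+1 x = trunc k x * prodg_ins (x k).
Proof.
apply: functional_extensionality_dep => j; rewrite prodg_mulE /trunc ltnS.
case: ltngtP => [jk|kj|->]; rewrite ?prodg_ins_in ?mul1g ?mulg1 //.
  by rewrite prodg_ins_out ?mulg1 // gtn_eqF.
by rewrite prodg_ins_out // ltn_eqF.
Qed.

Lemma trunc0 x : trunc 0 x = 1.
Proof. by []. Qed.

Lemma cylinder_trunc k x : cylinder k (trunc k x) x.
Proof. by move=> j jk; rewrite /trunc jk. Qed.

(** H contains each inserted coordinate of x, hence their product [trunc k x], which differs from x
    by an element of [cylinder k 1]. *)
Lemma subgroup_projP H k x : subgroup H -> cylinder k 1 `<=` H ->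
  H x <-> forall j, x j \in proj H j.
Proof.
move=> sH kH; split=> [Hx j|Hx]; first exact: mem_proj.
have [H1 HM _] := sH.
apply: (subgroup_cylinder sH kH _ (@cylinder_trunc k x)).
elim: {1}k => [|l IHl]; first by rewrite trunc0.
by rewrite truncS; apply: HM IHl (subgroup_ins sH kH (Hx l)).
Qed.

Lemma proj_cylinder H k j : subgroup H -> cylinder k 1 `<=` H -> k <= j ->
  proj H j = [set: T j]%G.
Proof.
move=> sH kH kj; apply/val_inj/setP => a; rewrite [RHS]inE; apply/projP => //.
exists (prodg_ins a); last exact: prodg_ins_in.
by apply: kH => i ik; rewrite prodg_ins_out // gtn_eqF // (leq_trans ik).
Qed.

Definition box (K : forall j, {group T j}) : set G := [set x | forall j, x j \in K j].

Lemma box_subgroup (K : forall j, {group T j}) : subgroup (box K).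
Proof.
split=> [j|x y xK yK j|x xK j]; first exact: group1.
  exact: groupM (xK j) (yK j).
by rewrite prodg_invE groupV; exact: xK.
Qed.

Lemma proj_box (K : forall j, {group T j}) j : proj (box K) j = K j.
Proof.
apply/val_inj/setP => a; apply/idP/idP.
  by case/(projP _ (box_subgroup K)) => x xK <-.
move=> aK; apply/(projP _ (box_subgroup K)); exists (prodg_ins a).
  move=> i; have [<-|ji] := eqVneq j i; first by rewrite prodg_ins_in.
  by rewrite prodg_ins_out.
exact: prodg_ins_in.
Qed.

Lemma box_cylinder K k : (forall j, k <= j -> K j = [set: T j]%G) ->
  cylinder k 1 `<=` box K.
Proof.
move=> kK x x1 j; have [jk|kj] := ltnP j k; first by rewrite -x1 ?group1.
by rewrite kK ?inE.
Qed.

Lemma box_open_subgroup K k : (forall j, k <= j -> K j = [set: T j]%G) ->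
  open_subgroup (box K).
Proof.
by move=> kK; exact: cylinder_open_subgroup (box_subgroup K) (box_cylinder kK).
Qed.

Lemma box_proj H : open_subgroup H -> box (proj H) = H.
Proof.
move=> oH; have [sH _] := oH; have [k kH] := open_subgroup_cylinder oH.
by apply/seteqP; split=> x; rewrite (subgroup_projP x sH kH).
Qed.

Lemma projS H A j : subgroup H -> subgroup A -> H `<=` A -> proj H j \subset proj A j.
Proof.
move=> sH sA HA; apply/fintype.subsetP => a /(projP _ sH)[x /HA Ax <-].
exact: mem_proj.
Qed.

Lemma boxS (K L : forall j, {group T j}) : (forall j, K j \subset L j) -> box K `<=` box L.
Proof. by move=> KL x xK j; exact: (fintype.subsetP (KL j)) _ (xK j). Qed.

Lemma boxT : box (fun j => [set: T j]%G) = [set: G].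
Proof. by apply/seteqP; split=> // x _ j; rewrite inE. Qed.

Lemma prodg_2generated :
    (forall j, exists a b : T j, <[a]> * <[b]> = [set: T j]%G) ->
  topologically_2generated G.
Proof.
move=> gen; pose a j := sval (cid (gen j)); pose b j := sval (cid (svalP (cid (gen j)))).
have gab j : <[a j]> * <[b j]> = [set: T j]%G := svalP (cid (svalP (cid (gen j)))).
exists a, b; set C := smallest _ _.
have sC : subgroup C.
  split=> [D [[]]//|x y xC yC D DC|x xC D DC]; have [[D1 DM DV] abD] := DC.
    by apply: DM; [exact: xC|exact: yC].
  by apply: DV; exact: xC.
have Ca : C a by move=> D [_]; apply; left.
have Cb : C b by move=> D [_]; apply; right.
apply/seteqP; split=> // z _ A /prodg_nbhsE[k kA].
(* D is C saturated by [cylinder k 1]. It is a subgroup determined by its projections, and each of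
   these contains both generators of T_j. *)
pose D := [set y : G | exists2 c, C c & cylinder k c y].
have [C1 CM CV] := sC.
have sD : subgroup D.
  split=> [|x y [c Cc cx] [d Cd dy]|x [c Cc cx]]; first by exists 1.
    by exists (c * d); [exact: CM | move=> j jk; rewrite !prodg_mulE cx ?dy].
  by exists c^-1; [exact: CV | move=> j jk; rewrite !prodg_invE cx].
have CD : C `<=` D by move=> c Cc; exists c.
have kD : cylinder k 1 `<=` D by move=> y y1; exists 1.
have [c Cc cz] : D z.
  apply/(subgroup_projP z sD kD) => j; suff -> : proj D j = [set: T j]%G by rewrite inE.
  apply/val_inj/eqP; rewrite /= finset.eqEsubset finset.subsetT /= -gab mul_subG //= cycle_subG;
    by apply: mem_proj => //; exact: CD.
by exists c; split=> //; apply: kA => j jk; rewrite cz.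
Qed.

End CoprimeProd.

(** * Supersolvability of the finite quotients *)

Section Supersolvable.
Variable T : nat -> finGroupType.
Local Notation G := (prodgroup T : topologicalGroupType).
Variables (gT : finGroupType) (f : G -> gT).
Hypotheses (fM : {morph f : x y / x * y}) (f_surj : range f = [set: gT]).
Implicit Types K L : forall j, {group T j}.

Local Notation img K := (img_group f (box K)).

Lemma img_boxP K u : u \in img K <-> exists2 x, box K x & f x = u.
Proof. exact: (img_groupP _ fM (box_subgroup K)). Qed.

Lemma img_box_normal K : (forall j, normal (K j) [set: T j]%G) -> normal (img K) [set: gT]%G.
Proof.
move=> nK; apply/normalP; split=> [|u _]; first exact: finset.subsetT.
apply/eqP; rewrite eqEcard cardJg leqnn andbT.
apply/fintype.subsetP=> _ /imsetP[v /img_boxP[x xK <-] ->].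
have [y _ <-] : range f u by rewrite f_surj.
have fV : f y^-1 = (f y)^-1.
  have f1 : f 1 = 1 by apply: (mulgI (f 1)); rewrite -fM !mulg1.
  by apply: (mulgI (f y)); rewrite -fM !mulgV.
apply/img_boxP; exists (y^-1 * (x * y)); last by rewrite !fM fV.
move=> j; rewrite !prodg_mulE prodg_invE.
rewrite -/(conjg (x j) (y j)) memJ_norm ?xK //.
by rewrite (fintype.subsetP (normal_norm (nK j))) ?inE.
Qed.

(** Enlarging one coordinate by a cyclic factor multiplies the image by a cyclic group, so the
    quotient of the two images is cyclic. *)
Lemma img_box_mul K L l (a : T l) : (forall j, l != j -> K j = L j) ->
  K l * <[a]> = L l -> img L = img K * <[f (prodg_ins a)]> :> {set gT}.
Proof.
move=> KL KLl; apply/eqP; rewrite finset.eqEsubset; apply/andP; split.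
  apply/fintype.subsetP=> _ /img_boxP[x xL <-].
  have : x l \in K l * <[a]> by rewrite KLl; exact: xL.
  case/mulsgP=> b _ bK /cycleP[n ->] xl.
  apply/mulsgP; exists (f (x * (prodg_ins a ^+ n)^-1)) (f (prodg_ins a ^+ n)).
  - apply/img_boxP; exists (x * (prodg_ins a ^+ n)^-1) => // j.
    rewrite prodg_mulE prodg_invE -prodg_insX.
    have [<-|lj] := eqVneq l j; first by rewrite prodg_ins_in xl mulgK.
    by rewrite prodg_ins_out // invg1 mulg1 KL //; exact: xL.
  - have -> : f (prodg_ins a ^+ n) = f (prodg_ins a) ^+ n.
      elim: n {xl} => [|n IHn]; last by rewrite !expgS fM IHn.
      by apply: (mulgI (f 1)); rewrite -fM !mulg1.
    exact: mem_cycle.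
  - by rewrite -fM mulgVK.
have sKL : box K `<=` box L.
  apply: boxS => j; have [<-|lj] := eqVneq l j; last by rewrite KL.
  by rewrite -KLl mulg_subl.
rewrite mul_subG //.
  by apply/fintype.subsetP=> u /img_boxP[x xK <-]; apply/img_boxP; exists x => //; exact: sKL.
rewrite cycle_subG; apply/img_boxP; exists (prodg_ins a) => // j.
have [<-|lj] := eqVneq l j; last by rewrite prodg_ins_out.
by rewrite prodg_ins_in -KLl; apply: (fintype.subsetP (mulg_subr _ _)); rewrite ?cycle_id.
Qed.

(** A chain as in [supersolvable] that stops at H, with normality still required in the whole group,
    so that it can be extended by induction. *)
Definition supersolvable_chain (H : {group gT}) := exists s : seq {group gT},
  path [rel H K : {group gT} | [&& H \subset K, normal K [set: gT]%G & cyclic (K / H)]] 1%G s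
  /\ last 1%G s = H.

Lemma img_box_chain K L l (a : T l) :
    (forall j, normal (K j) [set: T j]%G) -> (forall j, normal (L j) [set: T j]%G) ->
    (forall j, l != j -> K j = L j) -> K l * <[a]> = L l ->
  supersolvable_chain (img K) -> supersolvable_chain (img L).
Proof.
move=> nK nL KL KLl [s [ps ls]]; exists (rcons s (img L)).
rewrite last_rcons rcons_path ps ls; split=> //=.
have mulE := img_box_mul KL KLl.
apply/and3P; split; [by rewrite mulE mulg_subl|exact: img_box_normal|].
rewrite mulE quotientMidl quotient_cycle ?cycle_cyclic //.
by rewrite (fintype.subsetP (normal_norm (img_box_normal nK))) ?inE.
Qed.

Hypothesis f_open : forall A : set gT, open (f @^-1` A).
Variables a b : forall j, T j.
Hypotheses (na : forall j, normal (<[a j]>) [set: T j]%G)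
  (gab : forall j, <[a j]> * <[b j]> = [set: T j]%G).

(** Each factor is filled in two cyclic steps, by the normal subgroup <a_l> and then by <a_l><b_l>.
    Finitely many factors suffice because f is constant near 1. *)
Lemma img_supersolvable : supersolvable [set: gT]%G.
Proof.
pose K l j : {group T j} := if j < l then [set: T j]%G else 1%G.
pose L l j : {group T j} := if j == l then <[a j]>%G else K l j.
have nK l j : normal (K l j) [set: T j]%G by rewrite /K; case: ifP; rewrite ?normal_refl ?normal1.
have nL l j : normal (L l j) [set: T j]%G by rewrite /L; case: ifP.
have chainK l : supersolvable_chain (img (K l)).
  elim: l => [|l IHl].
    exists [::]; split=> //=; apply/val_inj/setP => u; apply/idP/idP.
      move=> /set1P->; apply/img_boxP; exists 1 => [j|]; first exact: group1.
      by apply: (mulgI (f 1)); rewrite -fM !mulg1.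
    case/img_boxP=> x x1 <-; have -> : x = 1.
      by apply: functional_extensionality_dep => j; have /set1P := x1 j.
    by apply/set1P/(mulgI (f 1)); rewrite -fM !mulg1.
  apply: (@img_box_chain (L l) _ l (b l)) => //.
  - by move=> j lj; rewrite /L /K eq_sym (negPf lj) ltnS (leq_eqVlt j l) eq_sym (negPf lj).
  - by rewrite /L /K eqxx ltnSn gab.
  apply: (@img_box_chain (K l) _ l (a l)) => //.
  - by move=> j lj; rewrite /L eq_sym (negPf lj).
  - by rewrite /L /K eqxx ltnn mul1g.
have [k kf] : exists k, cylinder k (1 : G) `<=` f @^-1` [set f 1].
  exact: (proj1 (prodg_openE _) (@f_open [set f 1]) 1 erefl).
have [s [ps ls]] := chainK k; exists s; split=> //; rewrite ls.
apply/val_inj/eqP; rewrite /= finset.eqEsubset finset.subsetT /=.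
apply/fintype.subsetP=> u _; have [x _ <-] : range f u by rewrite f_surj.
apply/img_boxP; exists (trunc k x).
  by move=> j; rewrite /trunc /K; case: ifP; rewrite inE.
rewrite -[in RHS](mulKVg (trunc k x) x) fM; have -> : f ((trunc k x)^-1 * x) = f 1.
  apply: kf => j jk; rewrite prodg_mulE prodg_invE.
  by rewrite (@cylinder_trunc _ k x j jk) mulVg.
by rewrite -fM mulg1.
Qed.

End Supersolvable.

Lemma prodg_prosupersolvable (T : nat -> finGroupType) :
    (forall j, exists a b : T j, normal (<[a]>) [set: T j]%G /\ <[a]> * <[b]> = [set: T j]%G) ->
  prosupersolvable (prodgroup T : topologicalGroupType).
Proof.
move=> gen; split=> [|gT f f_surj f_open]; first exact: prodg_profinite.
pose a j := sval (cid (gen j)); pose b j := sval (cid (svalP (cid (gen j)))).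
have gab j : normal (<[a j]>) [set: T j]%G /\ <[a j]> * <[b j]> = [set: T j]%G.
  exact: svalP (cid (svalP (cid (gen j)))).
apply: (@img_supersolvable T gT f _ f_surj f_open a b).
- exact: gmulfM.
- by move=> j; have [] := gab j.
- by move=> j; have [] := gab j.
Qed.

Lemma card_ge_finType (D : finType) U (A : set U) (h : D -> U) :
  injective h -> range h `<=` A -> (`I_#|D| #<= A)%card.
Proof.
move=> h_inj hA; apply: card_le_trans (subset_card_le hA).
pose g (i : 'I_#|D|) := h (enum_val i).
have g_inj : {in [set: 'I_#|D|] &, injective g} by move=> i j _ _ /h_inj/enum_val_inj.
have := inj_card_eq g_inj; rewrite card_eq_le => /andP[_].
have -> : range g = range h.
  apply/seteqP; split=> _ [i _ <-]; first by exists (enum_val i).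
  by exists (enum_rank i) => //; rewrite /g enum_rankK.
by apply: card_le_trans; have := @card_II #|D|; rewrite card_eq_le => /andP[].
Qed.

Lemma card_le_finType (D : finType) U (A : set U) (h : D -> U) :
  A `<=` range h -> (A #<= `I_#|D|)%card.
Proof.
move=> hA; apply: (card_le_trans (subset_card_le hA)).
pose g (i : 'I_#|D|) := h (enum_val i).
have -> : range h = range g.
  apply/seteqP; split=> _ [i _ <-]; last by exists (enum_val i).
  by exists (enum_rank i) => //; rewrite /g enum_rankK.
apply: (card_le_trans (card_image_le _ _)).
by have := @card_II #|D|; rewrite card_eq_le => /andP[].
Qed.

(** * Indices of subgroups of the product *)

Section Index.
Variable T : nat -> finGroupType.
Hypothesis coT : forall i j, i != j -> coprime #|T i| #|T j|.
Local Notation G := (prodgroup T : topologicalGroupType).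
Implicit Types (H : set G) (j k : nat).

(** Inserting representatives of distinct cosets of [proj H j] at coordinate j gives representatives
    of distinct cosets of H. *)
Lemma index_le_proj H j m : subgroup H -> index_le H m ->
  #|[set: T j]%SET : proj H j| <= m.
Proof.
move=> sH; rewrite /index_le => Hm; rewrite -card_lcosets.
pose h (i : 'I_#|lcosets (proj H j) [set: T j]%SET|) : set G :=
  [set prodg_ins (repr (enum_val i)) * x | x in H].
rewrite -card_le_II; apply: card_le_trans Hm.
rewrite -[X in `I_X]card_ord; apply: (card_ge_finType (h := h)); last first.
  by move=> _ [i _ <-]; exists (prodg_ins (repr (enum_val i))).
move=> i i' hii'; apply: enum_val_inj.
have [a _ Da] := lcosetsP (enum_valP i); have [b _ Db] := lcosetsP (enum_valP i').
have [H1 _ _] := sH.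
have : h i (prodg_ins (repr (enum_val i))) by exists 1; rewrite ?mulg1.
rewrite hii' => -[x Hx /(congr1 (fun y : G => y j))].
rewrite prodg_mulE !prodg_ins_in => Dx.
have ra : repr (enum_val i) \in a *: proj H j.
  by rewrite Da; exact: (mem_repr a (lcoset_refl _ _)).
have rb : repr (enum_val i') \in b *: proj H j.
  by rewrite Db; exact: (mem_repr b (lcoset_refl _ _)).
rewrite Da Db -(lcoset_eqP ra) -(lcoset_eqP rb) -Dx.
apply/lcoset_eqP; rewrite mem_lcoset mulKg.
exact: mem_proj.
Qed.

Lemma index_le_cylinder H k : subgroup H -> cylinder k 1 `<=` H ->
  index_le H (\prod_(j < k) #|T j|).
Proof.
move=> sH kH; rewrite /index_le.
pose D := {dffun forall i : 'I_k, T i}.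
have -> : (\prod_(j < k) #|T j| = #|{: D}|)%N.
  by rewrite card_dep_ffun foldrE big_map enumT.
(* Any point with the prescribed first k coordinates will do: since H contains [cylinder k 1], they
   determine its coset. *)
pose ext (t : D) : G := xget 1 [set x : G | forall i : 'I_k, x i = t i].
apply: (card_le_finType (h := fun t : D => [set ext t * x | x in H])).
move=> _ [x _ <-]; pose tx : D := [ffun i : 'I_k => x i]; exists tx => //.
have xy : cylinder k x (ext tx).
  have Etx : forall i : 'I_k, ext tx i = tx i.
    apply: (@xgetPex _ 1 [set z : G | forall i : 'I_k, z i = tx i]).
    by exists x => i; rewrite ffunE.
  by move=> j jk; rewrite (Etx (Ordinal jk)) ffunE.
have [_ HM HV] := sH.
have Hxy : H (x^-1 * ext tx).
  by apply: kH => j jk; rewrite prodg_mulE prodg_invE -xy // mulVg.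
apply/seteqP; split=> _ [y Hy <-].
  by exists (x^-1 * ext tx * y); [exact: HM|rewrite mulgA mulKVg].
exists ((x^-1 * ext tx)^-1 * y); first exact/HM/Hy/HV.
by rewrite invMg invgK !mulgA mulgV mul1g.
Qed.

Lemma finite_over_cylinder k :
  finite_set [set H : set G | subgroup H /\ cylinder k 1 `<=` H].
Proof.
pose D := {dffun forall i : 'I_k, {group T i}}.
pose ext (t : D) : set G := [set x | forall i : 'I_k, x i \in t i].
apply/finite_set_leP; exists #|{: D}|.
apply: (card_le_finType (h := ext)) => H [sH kH].
exists [ffun i : 'I_k => proj H i] => //; apply/seteqP; split=> x; last first.
  by move=> Hx i; rewrite ffunE mem_proj.
move=> Hx; apply/(subgroup_projP coT x sH kH) => j.
have [kj|jk] := leqP k j; first by rewrite (proj_cylinder sH kH kj) inE.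
by have := Hx (Ordinal jk); rewrite ffunE.
Qed.

End Index.

(** * Intersections of maximal subgroups *)

Section Maximal.
Variable T : nat -> finGroupType.
Local Notation G := (prodgroup T : topologicalGroupType).

Lemma maximal_preim j (M : {group T j}) : maximal M [set: T j]%SET ->
  @maximal_subgroup G [set x : G | x j \in M].
Proof.
move=> /maxgroupP[ltM maxM]; set A := [set x : G | _].
have sA : subgroup A.
  split=> [|x y xM yM|x xM]; rewrite /A /= ?prodg_mulE ?prodg_invE ?group1 ?groupV //.
  exact: groupM.
split.
- apply: (@cylinder_open_subgroup _ _ j.+1) => // x x1.
  by rewrite /A /= -x1 // group1.
- move=> AT; case/properP: ltM => _ [a _ /negP]; apply; have : A (prodg_ins a) by rewrite AT.
  by rewrite /A /= prodg_ins_in.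
move=> K sK AK.
have sMK : M \subset proj K j.
  apply/fintype.subsetP=> a aM; rewrite -(prodg_ins_in a); apply: mem_proj => //.
  by apply: AK; rewrite /A /= prodg_ins_in.
have [_ KM _] := sK.
have [pK|pK] := boolP (proj K j \proper [set: T j]%SET); [left|right].
  apply/seteqP; split=> // x Kx; rewrite /A /= -(maxM _ pK sMK).
  exact: mem_proj.
apply/seteqP; split=> // x _.
have : x j \in proj K j.
  by move: pK; rewrite properE finset.subsetT negbK /= => /fintype.subsetP; apply; rewrite inE.
case/(projP _ sK) => y Ky yx; rewrite -(mulKVg y x); apply: KM => //; apply: AK.
by rewrite /A /= prodg_mulE prodg_invE yx mulVg group1.
Qed.

Lemma box_intersection_of_maximals (K : forall j, {group T j}) :
    (forall j a, a \notin K j -> exists M : {group T j},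
      [/\ maximal M [set: T j]%SET, K j \subset M & a \notin M]) ->
  @intersection_of_maximals G (box K).
Proof.
move=> Kmax; exists [set M | maximal_subgroup M /\ box K `<=` M].
split=> [M [] //|]; apply/seteqP; split=> [x xK M [_]|x xM j]; first exact.
apply: contrapT => /negP/Kmax[M [maxM sKM /negP]]; apply.
apply: (xM [set y : G | y j \in M]); split; first exact: maximal_preim.
by move=> y yK; exact: (fintype.subsetP sKM).
Qed.

End Maximal.

(** * Conjugacy classes of boxes *)

Section ConjClass.
Variable T : nat -> finGroupType.
Local Notation G := (prodgroup T : topologicalGroupType).
Implicit Types (H : set G) (K L : forall j, {group T j}).

Lemma conj_class_conj H (g : G) : conj_class [set h ^ g | h in H] = conj_class H.
Proof.
apply/seteqP; split=> _ [x _ <-].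
  exists (g * x) => //; apply/seteqP; split=> y.
    by move=> [h Hh <-]; exists (h ^ g); [exists h|rewrite conjgM].
  by move=> [_ [h Hh <-] <-]; exists h => //; rewrite conjgM.
exists (g^-1 * x) => //; apply/seteqP; split=> y.
  by move=> [_ [h Hh <-] <-]; exists h => //; rewrite -conjgM mulKVg.
by move=> [h Hh <-]; exists (h ^ g); [exists h|rewrite -conjgM mulKVg].
Qed.

Lemma box_conj K L (g : G) : (forall j, K j :=: L j :^ g j) ->
  [set h ^ g | h in box L] = box K.
Proof.
have conjE (h x : G) j : (h ^ x) j = h j ^ x j by [].
move=> KL; apply/seteqP; split=> [_ [h hL <-] j|x xK].
  by rewrite KL conjE memJ_conjg; exact: hL.
exists (x ^ g^-1); last by rewrite conjgKV.
by move=> j; rewrite conjE prodg_invE -mem_conjg -KL; exact: xK.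
Qed.

Lemma conj_class_box K L : conj_class (box K) = conj_class (box L) ->
  forall j, #|K j| = #|L j|.
Proof.
move=> KL j; have : conj_class (box K) (box K).
  by exists 1 => //; apply: box_conj => i; rewrite conjsg1.
rewrite KL => -[g _ gL].
have gLK : box (fun i => L i :^ g i)%G = box K by rewrite -gL (@box_conj (fun i => L i :^ g i)%G L g).
by rewrite -(proj_box K j) -gLK proj_box cardJg.
Qed.

End ConjClass.

(** * Moebius function and counting *)

Section Mobius.
Variable B : nat -> block.
Hypothesis coB : forall i j, i != j -> coprime #|B i| #|B j|.
Local Notation G := (prodgroup B : topologicalGroupType).
Implicit Types (H : set G) (K L : forall j, {group B j}).

(** For open H almost every projection is the whole block, where the factor is 1, so this finitely
    supported product is the full one. *)
Definition prodg_mobius H : int :=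
  (\big[*%R/1]_(j \in [set: nat]) block_mobius (proj H j))%R.

Definition cofin_full k K := forall j, k <= j -> K j = [set: B j]%G.

Lemma prodg_mobius_box k K : cofin_full k K ->
  prodg_mobius (box K) = (\prod_(j < k) block_mobius (K j))%R.
Proof.
move=> kK; rewrite [RHS](fsbig_ord _ _ (fun j => block_mobius (K j))).
rewrite [RHS](fsbig_widen _ [set: nat]) //=.
  by apply: eq_fsbigr => j _; rewrite proj_box.
by move=> j [_ /negP]; rewrite -leqNgt => /kK /= ->; exact: block_mobiusT.
Qed.

Lemma open_subgroup_box H : open_subgroup H ->
  exists k, cofin_full k (proj H) /\ box (proj H) = H.
Proof.
move=> oH; have [sH _] := oH; have [k kH] := open_subgroup_cylinder oH; exists k.
by split=> [j|]; [exact: proj_cylinder|exact: box_proj].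
Qed.

Definition upd K i (L : {group B i}) : forall j, {group B j} := eqtype.dfwith K L.

Lemma upd_in K i (L : {group B i}) : upd K L i = L.
Proof. exact: eqtype.dfwith_in. Qed.
Lemma upd_out K i (L : {group B i}) j : i != j -> upd K L j = K j.
Proof. exact: eqtype.dfwith_out. Qed.

Lemma cofin_full_upd k K i (L : {group B i}) : cofin_full k K ->
  cofin_full (maxn k i.+1) (upd K L).
Proof.
move=> kK j; rewrite geq_max => /andP[kj ij].
by rewrite upd_out ?kK // ltn_eqF.
Qed.

Lemma prodg_mobius_upd k K i (L : {group B i}) : cofin_full k K ->
    K i = [set: B i]%G ->
  prodg_mobius (box (upd K L)) = (prodg_mobius (box K) * block_mobius L)%R.
Proof.
move=> kK Ki; set l := maxn k i.+1.
have il : i < l by rewrite leq_max leqnn orbT.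
have lK : cofin_full l K by move=> j lj; apply: kK; apply: leq_trans lj; exact: leq_maxl.
rewrite (prodg_mobius_box (cofin_full_upd L kK)) (prodg_mobius_box lK).
rewrite (bigD1 (Ordinal il)) //= [in RHS](bigD1 (Ordinal il)) //=.
rewrite upd_in Ki block_mobiusT mul1r mulrC; congr (_ * _)%R.
by apply: eq_bigr => j ji; rewrite upd_out // eq_sym.
Qed.

Lemma fsbig_overgroups i (H : {group B i}) :
  (\sum_(L \in [set L : {group B i} | H \subset L]) block_mobius L =
   \sum_(L : {group B i} | H \subset L) block_mobius L)%R.
Proof.
rewrite [RHS]bigfs ?index_enum_uniq //.
by move=> L _; rewrite mem_index_enum.
Qed.

Lemma prodg_mobiusP : mobius_function prodg_mobius.
Proof.
split.
  by rewrite -[X in prodg_mobius X]boxT (@prodg_mobius_box 0) ?big_ord0.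
move=> H oH nH; have [kH [fH HE]] := open_subgroup_box oH; have [sH _] := oH.
have [i nHi] : exists i, proj H i <> [set: B i]%G.
  apply: contrapT => nex; apply: nH; rewrite -HE -boxT; congr box.
  apply: functional_extensionality_dep => i; apply: contrapT => ne.
  by apply: nex; exists i.
pose S := [set K : set G | open_subgroup K /\ H `<=` K].
pose S1 := [set K : set G | S K /\ proj K i = [set: B i]%G].
pose S2 := [set L : {group B i} | proj H i \subset L].
(* Split off the coordinate i: its factor of the sum vanishes. *)
pose h (p : set G * {group B i}) : set G := box (upd (proj p.1) p.2).
have finS : finite_set S.
  have [k kH'] := open_subgroup_cylinder oH.
  apply: sub_finite_set (finite_over_cylinder coB k) => K [[sK _] HK].
  by split=> //; exact: subset_trans HK.
have finS1 : finite_set S1 by apply: sub_finite_set finS => K [].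
(* An overgroup of H corresponds to the pair of the same box made full at coordinate i and its
   original coordinate i. *)
have bij_h : set_bij (S1 `*` S2) S h.
  split.
  - move=> [K L] [/= [[oK HK] Ki] HL].
    have [k [fK KE]] := open_subgroup_box oK; split.
      exact: box_open_subgroup (cofin_full_upd L fK).
    rewrite -HE; apply: boxS => j.
    have [<-|ij] := eqVneq i j; first by rewrite upd_in.
    by rewrite upd_out //; apply: projS => //; have [] := oK.
  - move=> [K L] [K' L'] /set_mem[/= [[oK _] Ki] _] /set_mem[/= [[oK' _] Ki'] _] hKL.
    have E j : upd (proj K) L j = upd (proj K') L' j.
      by rewrite -(proj_box (upd (proj K) L)) -(proj_box (upd (proj K') L')) -/(h (K, L)) hKL.
    have := E i; rewrite !upd_in => ->; congr (_, _).
    rewrite -(box_proj coB oK) -(box_proj coB oK'); congr box.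
    apply: functional_extensionality_dep => j.
    have [<-|ij] := eqVneq i j; first by rewrite Ki Ki'.
    by have := E j; rewrite !upd_out.
  - move=> M [oM HM]; have [k [fM ME]] := open_subgroup_box oM; have [sM _] := oM.
    exists (box (upd (proj M) [set: B i]%G), proj M i).
      split; [split; [split|]|] => /=.
      + exact: box_open_subgroup (cofin_full_upd _ fM).
      + rewrite -HE; apply: boxS => j.
        have [<-|ij] := eqVneq i j; first by rewrite upd_in finset.subsetT.
        by rewrite upd_out //; exact: projS.
      + by rewrite proj_box upd_in.
      + exact: projS.
    rewrite /h /= -[RHS]ME; congr box; apply: functional_extensionality_dep => j.
    have [<-|ij] := eqVneq i j; first by rewrite upd_in.
    by rewrite upd_out // proj_box upd_out.
rewrite -/S (reindex_fsbig h (S1 `*` S2) S) //.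
rewrite (eq_fsbigr (fun p => prodg_mobius p.1 * block_mobius p.2)%R); last first.
  move=> [K L] /set_mem[/= [[oK _] Ki] _]; have [k [fK KE]] := open_subgroup_box oK.
  by rewrite /h (prodg_mobius_upd _ fK) // KE.
rewrite -(@pair_fsbig _ _ _ _ _ S1 S2
  (fun (K : set G) (L : {group B i}) => prodg_mobius K * block_mobius L)%R finS1 finite_finset).
rewrite fsbig1 // => K _; rewrite -mulr_fsumr fsbig_overgroups block_mobius_sum ?mulr0 //.
Qed.

End Mobius.

(** A trivial group does not have five subgroups of distinct orders. *)
Lemma block_card_gt1 (D : block) : 1 < #|D|.
Proof.
rewrite ltnNge -cardsT; apply/negP => /card_le1_trivg T1.
have R1 i : #|block_repr D i| = 1%N.
  by apply/eqP; rewrite -trivg_card1 -subG1 -T1 finset.subsetT.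
suff : ord0 = ord_max :> 'I_5 by [].
by apply: (@block_repr_card D); rewrite !R1.
Qed.

(** * Counting classes of index at most n_k *)

Section Counting.
Variable B : nat -> block.
Hypothesis large : forall j r, prime r -> r %| #|B j| -> \prod_(i < j) #|B i| < r.
Local Notation G := (prodgroup B : topologicalGroupType).
Local Notation n k := (\prod_(i < k) #|B i|)%N.
Implicit Types (H : set G) (K L : forall j, {group B j}).

Lemma prod_card_gt0 k : 0 < n k.
Proof. by rewrite prodn_gt0 // => i; rewrite (ltnW (block_card_gt1 _)). Qed.

Lemma dvdn_prod_card i j : i < j -> #|B i| %| n j.
Proof. by move=> ij; rewrite (bigD1 (Ordinal ij)) ?dvdn_mulr. Qed.

Lemma prod_card_le k l : k <= l -> n k <= n l.
Proof.
move=> /subnKC <-; elim: (l - k) => [|m IHm]; first by rewrite addn0.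
by rewrite addnS big_ord_recr /= (leq_trans IHm) // leq_pmulr // ltnW ?block_card_gt1.
Qed.

Lemma prod_card_ge k : k <= n k.
Proof.
elim: k => // k IHk; rewrite big_ord_recr /=.
apply: (@leq_trans (n k * 2)%N); last by rewrite leq_pmul2l ?prod_card_gt0 ?block_card_gt1.
by rewrite muln2 -addnn -addn1 leq_add ?prod_card_gt0.
Qed.

Lemma large_coprime i j : i != j -> coprime #|B i| #|B j|.
Proof.
wlog lt_ij : i j / i < j.
  by move=> Hw; case: (ltngtP i j) => // lt _; [|rewrite coprime_sym]; apply: Hw;
    rewrite // ltn_eqF.
move=> _; rewrite /coprime -[_ == _]negbK; apply/negP => ne1.
have g_gt1 : 1 < gcdn #|B i| #|B j|.
  by rewrite ltn_neqAle eq_sym ne1 gcdn_gt0 (ltnW (block_card_gt1 _)).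
have r_pr := pdiv_prime g_gt1; set r := pdiv _ in r_pr.
have /(dvdn_trans) rg : r %| gcdn #|B i| #|B j| by exact: pdiv_dvd.
have := large r_pr (rg _ (dvdn_gcdr _ _)).
by rewrite ltnNge dvdn_leq ?prod_card_gt0 // (dvdn_trans (rg _ (dvdn_gcdl _ _))) ?dvdn_prod_card.
Qed.
Local Notation coB := large_coprime.

(** A proper projection at j >= k would have an index divisible by a prime divisor of |B_j|, which
    exceeds n_j >= n_k. *)
Lemma index_le_full H k : open_subgroup H -> index_le H (n k) ->
  cofin_full k (proj H).
Proof.
move=> [sH _] Hk j kj; apply/eqP; apply: contraT => neT.
have := index_le_proj j sH Hk; set m := #|_ : _| => le_m.
have m_gt1 : 1 < m.
  rewrite indexg_gt1; apply: contra neT => sT.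
  by apply/eqP/val_inj/eqP; rewrite /= finset.eqEsubset finset.subsetT.
have := large (pdiv_prime m_gt1) (dvdn_trans (pdiv_dvd m) _ : pdiv m %| #|B j|).
rewrite -cardsT dvdn_indexg => /(_ isT); rewrite ltnNge => /negP; case.
by apply: leq_trans (prod_card_le kj); apply: leq_trans le_m; rewrite dvdn_leq ?pdiv_dvd ?(ltnW m_gt1).
Qed.

Definition repr_fam k (t : {ffun 'I_k -> 'I_5}) : forall j, {group B j} :=
  fun j => if insub j is Some i then block_repr (B j) (t i) else [set: B j]%G.

Lemma repr_fam_lt k (t : {ffun 'I_k -> 'I_5}) (j : 'I_k) :
  repr_fam t j = block_repr (B j) (t j).
Proof. by rewrite /repr_fam valK. Qed.

Lemma repr_fam_ge k (t : {ffun 'I_k -> 'I_5}) : cofin_full k (repr_fam t).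
Proof. by move=> j kj; rewrite /repr_fam insubN // -leqNgt. Qed.

Lemma index_le_repr k (t : {ffun 'I_k -> 'I_5}) :
  open_subgroup (box (repr_fam t) : set G) /\ index_le (box (repr_fam t) : set G) (n k).
Proof.
split; first exact: box_open_subgroup (@repr_fam_ge _ t).
by apply: index_le_cylinder; [exact: box_subgroup|exact: box_cylinder (@repr_fam_ge _ t)].
Qed.

(** If the product of Moebius values is nonzero, each of the first k coordinates is conjugate to one
    of four representatives, and the conjugating elements assemble into a single element of the
    product. *)
Lemma beta_tilde_le k : beta_tilde (@prodg_mobius B) (n k) <= 4 ^ k.
Proof.
rewrite /beta_tilde; apply: geq_card_fset_set.
have -> : (4 ^ k = #|{: {ffun 'I_k -> 'I_4}}|)%N by rewrite card_ffun !card_ord.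
pose w (t : {ffun 'I_k -> 'I_4}) : {ffun 'I_k -> 'I_5} := [ffun i => widen_ord (leqnSn 4) (t i)].
apply: (card_le_finType (h := fun t => conj_class (box (repr_fam (w t)) : set G))).
move=> _ [H [oH Hk muH] <-].
have fH := index_le_full oH Hk; have [sH _] := oH.
have HE : box (proj H) = H by exact: box_proj coB _ oH.
have rep (j : 'I_k) : exists (i : 'I_4) (g : B j),
    proj H j :=: block_repr (B j) (widen_ord (leqnSn 4) i) :^ g.
  have nz : block_mobius (proj H j) != 0%R.
    apply/eqP => z; apply: muH; rewrite -HE (prodg_mobius_box fH).
    by rewrite (bigD1 j) //= z mul0r.
  have [i [g [i4 E]]] := block_mobius_neq0 nz.
  by exists (Ordinal i4), g; rewrite E; congr (block_repr _ _ :^ _); exact: val_inj.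
pose t : {ffun 'I_k -> 'I_4} := [ffun j => sval (cid (rep j))].
exists t => //; have rep' j : exists g : B j, proj H j :=: repr_fam (w t) j :^ g.
  have [kj|jk] := leqP k j.
    by exists 1; rewrite (repr_fam_ge _ kj) (fH _ kj) conjsg1.
  have [g Eg] := svalP (cid (rep (Ordinal jk))); exists g; apply: (etrans Eg).
  by rewrite (repr_fam_lt (w t) (Ordinal jk)) !ffunE.
pose g : G := fun j => sval (cid (rep' j)).
rewrite -(conj_class_conj _ g) -[in RHS]HE; congr conj_class.
by apply: box_conj => j; exact: svalP (cid (rep' j)).
Qed.

Lemma gamma_tilde_ge k : 5 ^ k <= gamma_tilde G (n k).
Proof.
rewrite /gamma_tilde; apply: leq_card_fset_set.
  (* Finiteness has to come first: on an infinite set [fset_set] is empty and the lower bound would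
     fail. *)
  apply: finite_image.
  apply: sub_finite_set (finite_over_cylinder coB k) => H [oH Hk _].
  have [sH _] := oH; split=> //; rewrite -(box_proj coB oH).
  exact: box_cylinder (index_le_full oH Hk).
have -> : (5 ^ k = #|{: {ffun 'I_k -> 'I_5}}|)%N by rewrite card_ffun !card_ord.
apply: (card_ge_finType (h := fun t => conj_class (box (repr_fam t) : set G))).
  move=> t t' /conj_class_box E; apply/ffunP => j.
  by apply: (@block_repr_card (B j)); rewrite -!repr_fam_lt.
move=> _ [t _ <-]; exists (box (repr_fam t)) => //.
have [oR iR] := index_le_repr t; split=> //.
apply: box_intersection_of_maximals => j a.
have [kj|jk] := leqP k j; first by rewrite (repr_fam_ge _ kj) inE.
by rewrite (repr_fam_lt t (Ordinal jk)); exact: block_repr_maximal.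
Qed.

End Counting.

(** The choice of a block depends on the earlier ones only through the product of their orders, so
    the recursion [N] carries just this number. *)
Lemma exists_blocks : exists B : nat -> block,
  forall j r, prime r -> r %| #|B j| -> \prod_(i < j) #|B i| < r.
Proof.
pose next m := sval (cid (exists_block m)).
pose N := fix N k := if k is k'.+1 then (N k' * #|next (N k')|)%N else 1%N.
exists (fun k => next (N k)) => j r r_pr rB.
have -> : (\prod_(i < j) #|next (N i)| = N j)%N.
  by elim: (j) => [|k IHk]; rewrite ?big_ord0 ?big_ord_recr //= IHk.
exact: (svalP (cid (exists_block (N j)))).
Qed.

Local Open Scope ring_scope.

(** Arbitrarily small values occur in every tail, so each tail infimum is already 0. *)
Lemma limn_einf_eq0 (R : realType) (u : nat -> R) :
    (forall n, 0 <= u n) ->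
    (forall m e, 0 < e -> exists2 n, (m <= n)%N & u n <= e) ->
  limn_einf (fun n => (u n)%:E) = 0%E.
Proof.
move=> u_ge0 u_le; rewrite limn_einf_lim.
rewrite (_ : einfs _ = cst 0%E); first exact: lim_cst.
apply/funext => m; rewrite /einfs /=; apply/eqP; rewrite eq_le; apply/andP; split.
  apply/lee_addgt0Pr => e e_gt0; rewrite add0e.
  have [n mn un] := u_le m e e_gt0.
  by apply: ereal_inf_le; exists (u n)%:E; [exists n | rewrite lee_fin].
by apply: le_ereal_inf_tmp => _ [n _ <-]; rewrite lee_fin.
Qed.

Theorem mainTheorem8 (R : realType) :
  exists G : topologicalGroupType,
    [/\ prosupersolvable G, topologically_2generated G &
        exists mu : set G -> int, mobius_function mu /\
          limn_einf (fun n : nat =>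
            (((beta_tilde mu n)%:R / (gamma_tilde G n)%:R)%R : R)%:E) = 0%E].
Proof.
have [B large] := exists_blocks; have coB := large_coprime large.
exists (prodgroup B : topologicalGroupType); split.
- apply: prodg_prosupersolvable => j; exists (block_gen1 (B j)), (block_gen2 (B j)).
  by split; [exact: block_gen1_normal|exact: block_gens].
- apply: prodg_2generated coB _ => j; exists (block_gen1 (B j)), (block_gen2 (B j)).
  exact: block_gens.
exists (@prodg_mobius B); split; first exact: prodg_mobiusP.
apply: limn_einf_eq0 => [n|m e e_gt0]; first by rewrite divr_ge0.
(* Besides making the bound (4/5)^k small, k is taken at least m; then n_k >= k lies in the tail
   from m on. *)
have [k mk ek] : exists2 k, (m <= k)%N & (4%:R / 5%:R) ^+ k <= e :> R.
  have r1 : `|4%:R / 5%:R : R| < 1 by rewrite ger0_norm ?divr_ge0 // ltr_pdivrMr ?mul1r ?ltr_nat ?ltr0n.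
  have /cvgrPdist_le/(_ _ e_gt0)[N _ HN] := cvg_expr r1.
  exists (maxn m N); first exact: leq_maxl.
  have := HN (maxn m N) (leq_maxr _ _); rewrite sub0r normrN; apply: le_trans.
  exact: ler_norm.
exists (\prod_(i < k) #|B i|)%N; first exact: leq_trans mk (prod_card_ge B k).
apply: le_trans ek; have gk := gamma_tilde_ge large k.
rewrite expr_div_n -!natrX ler_pdivlMr ?ltr0n ?expn_gt0 // mulrAC.
rewrite ler_pdivrMr ?ltr0n ?(leq_trans _ gk) ?expn_gt0 // -!natrM ler_nat.
by rewrite leq_mul // beta_tilde_le.
Qed.
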